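(* Let $\mathcal{X}$ be a nonempty open subset of a Euclidean space and let $f:\mathcal{X}\to\mathbb{R}$ be real analytic, bounded below and proper. The following two statements are equivalent: (1) $f$ satisfies a class-$\mathcal{K}_{\mathrm{SAT}}$ lower bound. (2) $f$ satisfies a local Polyak-Łojasiewicz inequality, and $f$ satisfies a $\mathcal{PD}$ lower bound with a comparison function $\alpha$ such that $\liminf_{r\to\infty}\alpha(r)>0$.
   Context: Let $\underline f=\inf_{x\in\mathcal{X}}f(x)$. A function $f$ bounded below is proper if all its sublevel sets are compact subsets of $\mathcal{X}$ (preimages of compact sets are compact). Let $\mathbb{R}_+=[0,\infty)$. A function $\alpha:\mathbb{R}_+\to\mathbb{R}$ is positive-definite (class $\mathcal{PD}$) if $\alpha(0)=0$ and $\alpha(r)>0$ for all $r\ne 0$. A function $\alpha$ is of class $\mathcal{K}_{\mathrm{SAT}}$ if there are constants $a,b>0$ with $\alpha(r)=\sqrt{\frac{ar}{b+r}}$ for all $r\ge 0$. $f$ satisfies a class-$\mathcal{K}_{\mathrm{SAT}}$ (respectively $\mathcal{PD}$) lower bound with comparison function $\alpha$ if $\alpha$ is of class $\mathcal{K}_{\mathrm{SAT}}$ (respectively $\mathcal{PD}$) and $\|\nabla f(x)\|\ge\alpha(f(x)-\underline f)$ for all $x\in\mathcal{X}$; it satisfies a class-$\mathcal{K}_{\mathrm{SAT}}$ lower bound if this holds for some $\alpha$ of that class. $f$ satisfies a local Polyak-Łojasiewicz inequality if there exist $\epsilon>0$ and $\mu>0$ such that $\|\nabla f(x)\|\ge\sqrt{\mu\,(f(x)-\underline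 f)}$ for every $x\in\mathcal{X}$ with $f(x)-\underline f\le\epsilon$. *)

(* Defs.v *)
From mathcomp Require Import all_boot all_order all_algebra.
From mathcomp Require Import all_classical all_reals all_analysis.
From mathcomp Require Import summability.

Set Implicit Arguments.
Unset Strict Implicit.
Unset Printing Implicit Defensive.

Import Order.TTheory GRing.Theory Num.Theory.
Import numFieldNormedType.Exports.

Local Open Scope classical_set_scope.
Local Open Scope ring_scope.

(* The norm that the library puts on 'rV[R]_n is the sup norm; it induces the
   usual topology but it is not the Euclidean norm. *)
Definition enorm (R : realType) (n : nat) (v : 'rV[R]_n) : R :=
  Num.sqrt (\sum_(i < n) v 0 i ^+ 2).

Definition gradient (R : realType) (n : nat) (f : 'rV[R]_n -> R)
    (x : 'rV[R]_n) : 'rV[R]_n :=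
  \row_(i < n) 'D_(delta_mx 0 i) f x.

Definition monomial (R : realType) (n : nat) (m : {ffun 'I_n -> nat})
    (h : 'rV[R]_n) : R :=
  \prod_(i < n) h 0 i ^+ m i.

(* Convergence along the directed set of finite subsets of the multi-indices is
   unconditional, i.e. absolute, convergence. *)
Definition real_analytic_on (R : realType) (n : nat) (X : set 'rV[R]_n)
    (f : 'rV[R]_n -> R) : Prop :=
  forall x, X x -> exists c : {ffun 'I_n -> nat} -> R,
    \forall y \near x,
      partial_sum (fun m => c m * monomial m (y - x)) @ totally --> f y.

Definition bounded_below_on (R : realType) (n : nat) (X : set 'rV[R]_n)
    (f : 'rV[R]_n -> R) : Prop :=
  has_lbound (f @` X).

Definition infimum_on (R : realType) (n : nat) (X : set 'rV[R]_n)
    (f : 'rV[R]_n -> R) : R :=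
  inf (f @` X).

Definition proper_on (R : realType) (n : nat) (X : set 'rV[R]_n)
    (f : 'rV[R]_n -> R) : Prop :=
  forall c : R, compact [set x | X x /\ f x <= c].

(* A comparison function [0, +oo[ -> R is encoded as a total function on R, whose
   values at negative arguments are irrelevant. *)
Definition classPD (R : realType) (alpha : R -> R) : Prop :=
  alpha 0 = 0 /\ forall r, 0 < r -> 0 < alpha r.

Definition classKSAT (R : realType) (alpha : R -> R) : Prop :=
  exists a b : R, [/\ 0 < a, 0 < b &
    forall r, 0 <= r -> alpha r = Num.sqrt (a * r / (b + r))].

Definition gradient_lower_bound (R : realType) (n : nat) (X : set 'rV[R]_n)
    (f : 'rV[R]_n -> R) (alpha : R -> R) : Prop :=
  forall x, X x -> alpha (f x - infimum_on X f) <= enorm (gradient f x).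

Definition local_PL (R : realType) (n : nat) (X : set 'rV[R]_n)
    (f : 'rV[R]_n -> R) : Prop :=
  exists eps mu : R, [/\ 0 < eps, 0 < mu &
    forall x, X x -> f x - infimum_on X f <= eps ->
      Num.sqrt (mu * (f x - infimum_on X f)) <= enorm (gradient f x)].

(* Main.v *)
Require Import Defs.
From mathcomp Require Import all_boot all_order all_algebra.
From mathcomp Require Import finmap.
From mathcomp Require Import all_classical all_reals all_analysis.
From mathcomp Require Import summability.
From mathcomp Require Import lra.
Import Order.TTheory GRing.Theory Num.Theory.
Import numFieldNormedType.Exports.
Local Open Scope classical_set_scope.
Local Open Scope ring_scope.

(** Write g for the gap between f and its infimum.  A saturating comparison
function sqrt (a g / (b + g)) behaves like sqrt (a g / b) for small g and is
bounded below by a positive constant for large g, so it gives both the local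
Polyak-Lojasiewicz inequality (take the threshold b) and a positive-definite
bound with positive limit inferior.

Conversely, the Polyak-Lojasiewicz inequality controls the gradient where
g <= eps, and the limit inferior bounds it below by some c1 > 0 where g > M.
On the intermediate band eps <= g <= M the positive-definite comparison function
need not be bounded away from 0, because it is an arbitrary function; it only
says that the gradient does not vanish there.  As f is proper, the band is
compact, and the norm of the gradient, being continuous, has a positive minimum
c2 on it ([gradient_lower_bound_band]).  With c = min (c1, c2) and b = 1, the
constant a = min (mu, c ^ 2) works everywhere, since a g / (1 + g) is at most
both mu g and c ^ 2.

Analyticity supplies the continuity of f and of its partial derivatives
([analytic_continuous], [analytic_partial_continuous]).  Unconditional
convergence of the power series on a cube gives absolute convergence at its corner
([unconditional_abs_summable]), which dominates the series on a smaller cube, and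
a dominated sum of continuous functions is continuous
([dominated_sum_continuous]).  Instead of differentiating the series, take its
difference quotients: the difference quotient of a monomial extends to a polynomial in
the base point h and the increment t, the series of these polynomials is still
dominated on the cube of half the size, so its sum q (h, t) is continuous, and
the derivative is q (h, 0). *)

(** * Unconditional sums *)

Set Implicit Arguments.
Unset Strict Implicit.
Unset Printing Implicit Defensive.

#[local] Existing Instance totally_filter.

Definition abs_summable (R : realType) (I : choiceType) (a : I -> R) : Prop :=
  exists M : R, forall J, partial_sum (fun i => `|a i|) J <= M.

Lemma partial_sumE (R : realType) (I : choiceType) (a : I -> R) J :
  partial_sum a J = \sum_(i <- J) a i.
Proof. by rewrite /partial_sum -(big_seq_fsetE _ J xpredT a). Qed.

Lemma partial_sumB_subset (R : realType) (I : choiceType) (a : I -> R)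
    (J0 J : {fset I}) : (J0 `<=` J)%fset ->
  partial_sum a J - partial_sum a J0 = \sum_(i <- J | i \notin J0) a i.
Proof.
move=> sJ; rewrite !partial_sumE (big_fsetID _ (mem J0) J) /=.
have -> : [fset x in J | x \in J0]%fset = J0.
  apply/fsetP => i; rewrite !inE; apply/andP/idP => [[]//|iJ0]; split=> //.
  exact: (fsubsetP sJ).
by rewrite big_fset /= [X in X - _]addrC addrK.
Qed.

Lemma partial_sumB_dominated (R : realType) (I : choiceType) (a b : I -> R)
    (J0 J : {fset I}) : (forall i, `|a i| <= b i) -> (J0 `<=` J)%fset ->
  `|partial_sum a J - partial_sum a J0| <= partial_sum b J - partial_sum b J0.
Proof.
move=> ab sJ; rewrite !partial_sumB_subset//.
by apply: le_trans (ler_norm_sum _ _ _) _; apply: ler_sum.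
Qed.

(** Beyond some finite J0 all partial sums are within 1 of the limit.  Adding to J0
only the indices of nonnegative terms, and then those of negative terms, changes
the partial sum by at most 2 each time; together the two changes are the sum of
the absolute values outside J0. *)
Lemma unconditional_abs_summable (R : realType) (I : choiceType) (a : I -> R) (l : R) :
  partial_sum a @ totally --> l -> abs_summable a.
Proof.
move=> /cvgrPdist_le /(_ 1 ltr01) [J0 _ near_l].
have osc J1 J : (J0 `<=` J1)%fset -> (J1 `<=` J)%fset ->
    `|partial_sum a J - partial_sum a J1| <= 2.
  move=> s01 s1; have := near_l _ (fsubset_trans s01 s1); have := near_l _ s01.
  rewrite /= !ler_norml => /andP[? ?] /andP[? ?]; lra.
set A := fun i => `|a i|.
exists (partial_sum A J0 + 4) => J'.
pose J := (J0 `|` J')%fset.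
have s0 : (J0 `<=` J)%fset by exact: fsubsetUl.
have s' : (J' `<=` J)%fset by exact: fsubsetUr.
have leJ : partial_sum A J' <= partial_sum A J.
  by rewrite -subr_ge0 partial_sumB_subset//; apply: sumr_ge0 => i _; exact: normr_ge0.
apply: le_trans leJ _.
(* J1 splits J at the signs outside J0. *)
pose J1 := [fset i in J | (i \in J0) || (0 <= a i)]%fset.
have s01 : (J0 `<=` J1)%fset.
  by apply/fsubsetP => i iJ0; rewrite !inE iJ0.
have s1 : (J1 `<=` J)%fset by apply/fsubsetP => i; rewrite !inE => /andP[].
have pos : partial_sum A J1 - partial_sum A J0 = partial_sum a J1 - partial_sum a J0.
  rewrite !partial_sumB_subset// big_seq_cond [RHS]big_seq_cond; apply: eq_bigr => i.
  rewrite /J1 !inE => /andP[/andP[_ /orP[->//|/ger0_norm]]] //.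
have neg : partial_sum A J - partial_sum A J1 = - (partial_sum a J - partial_sum a J1).
  rewrite !partial_sumB_subset// -sumrN big_seq_cond [RHS]big_seq_cond; apply: eq_bigr => i.
  rewrite /J1 !inE => /andP[-> /=]; rewrite negb_or -ltNge => /andP[_].
  exact: ltr0_norm.
have := osc _ _ (fsubset_refl _) s01; have := osc _ _ s01 s1.
rewrite -[partial_sum A J](subrK (partial_sum A J1)) neg.
rewrite -[partial_sum A J1](subrK (partial_sum A J0)) pos.
rewrite !ler_norml => /andP[? ?] /andP[? ?]; lra.
Qed.

(** The set J0 depends on the dominating family only: this uniformity is what makes
[dominated_sum_continuous] work. *)
Lemma summable_uniform_tail (R : realType) (I : choiceType) (b : I -> R) (e : R) :
  abs_summable b -> 0 < e ->
  exists J0 : {fset I}, forall a : I -> R, (forall i, `|a i| <= `|b i|) ->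
    forall J, (J0 `<=` J)%fset -> `|partial_sum a J - partial_sum a J0| <= e.
Proof.
move=> [M bM] e0; pose S := range (partial_sum (fun i => `|b i|)).
have supS : has_sup S.
  split; first by exists (partial_sum (fun i => `|b i|) fset0); exists fset0.
  by exists M => _ [J _ <-].
have [_ [J0 _ <-] J0e] := sup_adherent e0 supS.
exists J0 => a ab J sJ; apply: le_trans (partial_sumB_dominated ab sJ) _.
have : partial_sum (fun i => `|b i|) J <= sup S by apply: sup_upper_bound => //; exists J.
lra.
Qed.

Lemma dominated_series_cvg (R : realType) (I : choiceType) (a b : I -> R) :
  abs_summable b -> (forall i, `|a i| <= `|b i|) ->
  partial_sum a @ totally --> sum a.
Proof.
move=> sb ab; apply: cauchy_cvg; apply: cauchy_exP => e e0.
have [|J0 J0e] := @summable_uniform_tail _ _ _ (e / 2) sb; first by lra.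
exists (partial_sum a J0); exists J0 => // J sJ.
by rewrite /= -ball_normE /= distrC; apply: le_lt_trans (J0e _ ab _ sJ) _; lra.
Qed.

(** The Weierstrass M-test: up to an error that is uniform in y, the sum is a
finite partial sum, which is continuous. *)
Lemma dominated_sum_continuous (R : realType) (I : choiceType) (T : topologicalType)
    (F : T -> I -> R) (b : I -> R) (z : T) :
  abs_summable b ->
  (\forall y \near z, forall i, `|F y i| <= `|b i|) ->
  (forall i, {for z, continuous (F ^~ i)}) ->
  {for z, continuous (fun y => sum (F y))}.
Proof.
move=> sb Fb Fc; apply/cvgrPdist_le => e e0.
have [|J0 J0e] := @summable_uniform_tail _ _ _ (e / 3) sb; first by lra.
have tail y : (forall i, `|F y i| <= `|b i|) -> `|sum (F y) - partial_sum (F y) J0| <= e / 3.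
  move=> yb; have Fy := dominated_series_cvg sb yb.
  have D : `|partial_sum (F y) J - partial_sum (F y) J0| @[J --> totally]
      --> `|sum (F y) - partial_sum (F y) J0|.
    by apply: cvg_norm; apply: cvgB => //; exact: cvg_cst.
  by apply: (cvgr_to_le D); exists J0 => // J; exact: J0e.
have Sc : partial_sum (F y) J0 @[y --> z] --> partial_sum (F z) J0.
  by apply: cvg_big => [|i _]; [exact: add_continuous | exact: Fc].
have zb := nbhs_singleton Fb.
move/cvgrPdist_le : Sc => /(_ (e / 3)) Sc.
near=> y.
have yb : forall i, `|F y i| <= `|b i| by near: y.
have : `|partial_sum (F z) J0 - partial_sum (F y) J0| <= e / 3.
  by near: y; apply: Sc; lra.
have := tail _ yb; have := tail _ zb.
by rewrite !ler_norml => /andP[? ?] /andP[? ?] /andP[? ?]; lra.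
Unshelve. all: by end_near. Qed.

(** * Monomials and their difference quotients *)

Definition mdeg (n : nat) (m : {ffun 'I_n -> nat}) : nat := (\sum_(i < n) m i)%N.

Lemma monomial_const (R : realType) (n : nat) (m : {ffun 'I_n -> nat}) (r : R) :
  monomial m (const_mx r) = r ^+ mdeg m.
Proof.
rewrite /monomial /mdeg -prodrXr; apply: eq_bigr => i _; by rewrite mxE.
Qed.

Lemma monomial_le (R : realType) (n : nat) (m : {ffun 'I_n -> nat}) (h : 'rV[R]_n) (r : R) :
  (forall j, `|h 0 j| <= r) -> `|monomial m h| <= r ^+ mdeg m.
Proof.
move=> hr; rewrite -monomial_const normr_prod; apply: ler_prod => j _.
by rewrite normr_ge0 normrX mxE lerXn2r ?nnegrE// (le_trans _ (hr j)).
Qed.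

(** The quotient of [monomial m (h + t *: delta_mx 0 i) - monomial m h] by t, with
the division carried out by the factorization of a difference of powers, so that
t = 0 is allowed and gives the partial derivative of the monomial. *)
Definition monomial_quotient (R : realType) (n : nat) (i : 'I_n)
    (m : {ffun 'I_n -> nat}) (h : 'rV[R]_n) (t : R) : R :=
  (\sum_(l < m i) (h 0 i + t) ^+ ((m i).-1 - l) * h 0 i ^+ l) *
  \prod_(j < n | j != i) h 0 j ^+ m j.

Lemma monomial_quotientE (R : realType) (n : nat) (i : 'I_n)
    (m : {ffun 'I_n -> nat}) (h : 'rV[R]_n) (t : R) :
  monomial m (h + t *: delta_mx 0 i) - monomial m h = t * monomial_quotient i m h t.
Proof.
rewrite /monomial (bigD1 i)//= [X in _ - X](bigD1 i)//=.
rewrite [X in _ * X - _](eq_bigr (fun j => h 0 j ^+ m j)); last first.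
  by move=> j ji; rewrite !mxE eqxx (negbTE ji) mulr0 addr0.
rewrite !mxE !eqxx mulr1 -mulrBl subrXX /monomial_quotient mulrA.
by congr (_ * _ * _); rewrite addrAC subrr add0r.
Qed.

(** The quotient has m i terms of degree one less than the monomial.  Doubling the
radius absorbs the factor m i, since m i <= 2 ^ m i. *)
Lemma monomial_quotient_le (R : realType) (n : nat) (i : 'I_n)
    (m : {ffun 'I_n -> nat}) (h : 'rV[R]_n) (t r : R) :
  0 < r -> (forall j, `|h 0 j| <= r) -> `|h 0 i + t| <= r ->
  `|monomial_quotient i m h t| <= r^-1 * (r *+ 2) ^+ mdeg m.
Proof.
move=> r0 hr tr; have r_ge0 := ltW r0.
rewrite -(ler_pM2l r0) mulrA divff ?gt_eqF// mul1r.
rewrite normrM mulrA /mdeg -prodrXr [leRHS](bigD1 i)//=.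
apply: ler_pM; rewrite ?normr_ge0 ?mulr_ge0//; last first.
  rewrite normr_prod; apply: ler_prod => j _.
  rewrite normr_ge0 normrX lerXn2r ?nnegrE ?mulrn_wge0//.
  by rewrite (le_trans (hr j))// mulr2n lerDl.
apply: (@le_trans _ _ (r * \sum_(l < m i) r ^+ (m i).-1)).
  apply: ler_wpM2l => //; apply: le_trans (ler_norm_sum _ _ _) _.
  apply: ler_sum => l _.
  have lm : (l <= (m i).-1)%N by case: (m i) l => [[]|k l]//; rewrite -ltnS.
  rewrite normrM !normrX -[in leRHS](subnK lm) exprD.
  by apply: ler_pM; rewrite ?exprn_ge0// lerXn2r ?nnegrE.
rewrite sumr_const card_ord -mulr_natr.
case: (m i) => [|k]; first by rewrite !mulr0 expr0 ler01.
rewrite /= mulrA -exprS -(mulr_natr r 2) exprMn ler_wpM2l ?exprn_ge0//.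
by rewrite -natrX ler_nat ltnW// ltn_expl.
Qed.

Lemma monomial_continuous (R : realType) (n : nat) (m : {ffun 'I_n -> nat}) :
  continuous (@monomial R n m).
Proof.
rewrite /monomial; refine (continuous_big (@mul_continuous R) _) => j _ h.
exact: (continuous_comp (f := fun h : 'rV[R]_n => h 0 j) (@coord_continuous _ _ _ _ _ h)
  (@exprn_continuous R (m j) _)).
Qed.

Lemma monomial_quotient_continuous (R : realType) (n : nat) (i : 'I_n)
    (m : {ffun 'I_n -> nat}) :
  continuous (fun p : 'rV[R]_n * R => monomial_quotient i m p.1 p.2).
Proof.
have coordc j : continuous (fun p : 'rV[R]_n * R => p.1 0 j).
  by move=> p; exact: (continuous_comp (f := fst) cvg_fst (@coord_continuous _ _ _ _ _ _)).
have powc (g : 'rV[R]_n * R -> R) k : continuous g -> continuous (fun p => g p ^+ k).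
  by move=> gc p; exact: (continuous_comp (gc p) (@exprn_continuous R k _)).
have sumc : continuous (fun p : 'rV[R]_n * R => p.1 0 i + p.2).
  by move=> p; apply: cvgD; [exact: coordc | exact: cvg_snd].
move=> p; apply: cvgM; move: p.
  refine (continuous_big (@add_continuous R) _) => l _ p.
  by apply: cvgM; [exact: (powc _ _ sumc) | exact: (powc _ _ (coordc i))].
refine (continuous_big (@mul_continuous R) _) => j _; exact: (powc _ _ (coordc j)).
Qed.

(** * Continuity of analytic functions and of their partial derivatives *)

Lemma continuous_at_near_eq (T U : topologicalType) (f g : T -> U) (x : T) :
  (\forall y \near x, f y = g y) -> {for x, continuous g} -> {for x, continuous f}.
Proof.
move=> fg gc; rewrite /prop_for /continuous_at (nbhs_singleton fg).
apply: cvg_trans gc; apply: near_eq_cvg.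
by apply: filterS fg => y ->.
Qed.

Lemma abs_summableZ (R : realType) (I : choiceType) (k : R) (a : I -> R) :
  abs_summable a -> abs_summable (fun i => k * a i).
Proof.
move=> [M aM]; exists (`|k| * M) => J; rewrite partial_sumE.
rewrite (eq_bigr (fun i => `|k| * `|a i|)) => [|i _]; last exact: normrM.
by rewrite -mulr_sumr -(partial_sumE (fun i => `|a i|)) ler_wpM2l.
Qed.

Lemma near_coord_le (R : realType) (n : nat) (x : 'rV[R]_n) (e : R) :
  0 < e -> \forall y \near x, forall j, `|(y - x) 0 j| <= e.
Proof.
move=> e0; apply: filterS (nbhsx_ballx x e e0) => y [_ xy] j.
by rewrite !mxE distrC ltW//; exact: xy.
Qed.

(** The radius is written as r *+ 2 to match [monomial_quotient_le], which bounds
difference quotients on the cube of size r by the power series at the corner of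
the cube of size 2 r. *)
Lemma power_series_domination (R : realType) (n : nat) (f : 'rV[R]_n -> R) (x : 'rV[R]_n)
    (c : {ffun 'I_n -> nat} -> R) :
  (\forall y \near x, partial_sum (fun m => c m * monomial m ((y : 'rV[R]_n) - x))
    @ totally --> f y) ->
  exists r : R, [/\ 0 < r,
    abs_summable (fun m => c m * (r *+ 2) ^+ mdeg m) &
    forall y : 'rV[R]_n, (forall j, `|(y - x) 0 j| <= r *+ 2) ->
      partial_sum (fun m => c m * monomial m (y - x)) @ totally --> f y].
Proof.
move=> /nbhs_ballP[e /= e0 fE]; exists (e / 4); split; first by lra.
  have /fE : ball x e (x + const_mx ((e / 4) *+ 2)).
    split=> // i j; rewrite -ball_normE /= !mxE opprD addrA subrr add0r normrN ger0_norm; lra.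
  rewrite addrC addKr => /unconditional_abs_summable.
  by under [X in abs_summable X]eq_fun do rewrite monomial_const.
move=> y yx; apply: fE; split=> // i j; rewrite -ball_normE /= distrC ord1.
by have := yx j; rewrite !mxE => /le_lt_trans; apply; lra.
Qed.

Lemma analytic_continuous (R : realType) (n : nat) (X : set 'rV[R]_n) (f : 'rV[R]_n -> R)
    (x : 'rV[R]_n) : real_analytic_on X f -> X x -> {for x, continuous f}.
Proof.
move=> fX /fX[c /power_series_domination[r [r0 sb fE]]].
have r20 : 0 < r *+ 2 by lra.
have Sc : {for x, continuous (fun y : 'rV[R]_n =>
    summability.sum (fun m => c m * monomial m (y - x)))}.
  apply: (dominated_sum_continuous sb).
    apply: filterS (near_coord_le x r20) => y yx m.
    rewrite !normrM ler_wpM2l//; apply: le_trans (monomial_le m yx) _.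
    exact: ler_norm.
  have subc : continuous (fun y : 'rV[R]_n => y - x).
    by move=> y; exact: (cvgB (F := nbhs y) cvg_id (cvg_cst x)).
  move=> m; exact: (cvgMl_tmp (F := nbhs x)
    (continuous_comp (subc x) (@monomial_continuous _ _ m _))).
have fS (y : 'rV[R]_n) : (forall j, `|(y - x) 0 j| <= r *+ 2) ->
    f y = summability.sum (fun m => c m * monomial m (y - x)).
  by move=> /fE/cvg_lim <-.
by apply: (continuous_at_near_eq _ Sc); apply: filterS (near_coord_le x r20) => y /fS.
Qed.

(** Where F p is the family of difference quotients at p = (y, t), the sum q of F p
is continuous at all (y, 0) with y near x: continuity in t identifies q (y, 0)
with the derivative at y, and continuity in y at x is the claim. *)
Lemma analytic_partial_continuous (R : realType) (n : nat) (X : set 'rV[R]_n)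
    (f : 'rV[R]_n -> R) (i : 'I_n) (x : 'rV[R]_n) :
  real_analytic_on X f -> X x -> {for x, continuous (fun y => 'D_(delta_mx 0 i) f y)}.
Proof.
move=> fX /fX[c /power_series_domination[r [r0 sb fE]]].
have r20 : 0 < r / 2 by lra.
pose F (p : 'rV[R]_n * R) m := c m * monomial_quotient i m (p.1 - x) p.2.
pose q p := summability.sum (F p).
have sumb := abs_summableZ r^-1 sb.
have Fb p : (forall j, `|(p.1 - x) 0 j| <= r / 2) -> `|p.2| <= r / 2 ->
    forall m, `|F p m| <= `|r^-1 * (c m * (r *+ 2) ^+ mdeg m)|.
  move=> px p2 m; rewrite /F [r^-1 * _]mulrCA normrM [leRHS]normrM ler_wpM2l//.
  apply: (le_trans (monomial_quotient_le _ r0 _ _)).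
  - by move=> j; apply: le_trans (px j) _; lra.
  - by apply: le_trans (ler_normD _ _) _; have := px i; lra.
  - exact: ler_norm.
have qc (y : 'rV[R]_n) : (forall j, `|(y - x) 0 j| <= r / 4) -> {for (y, 0), continuous q}.
  move=> yx; apply: (dominated_sum_continuous sumb).
    exists ([set y' : 'rV[R]_n | forall j, `|(y' - y) 0 j| <= r / 4],
      [set t | `|t| <= r / 2]) => /=.
      split; first by apply: near_coord_le; lra.
      exact: (@nbhs0_le R R _ r20).
    move=> [y' t] /= [y'y tr]; apply: Fb => //= j.
    rewrite -(subrK y y') -addrA mxE; apply: le_trans (ler_normD _ _) _.
    by have := y'y j; have := yx j; lra.
  have sc : continuous (fun p : 'rV[R]_n * R => (p.1 - x, p.2)).
    by move=> p; exact: (cvg_pair (cvgB (F := nbhs p) cvg_fst (cvg_cst x)) cvg_snd).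
  move=> m; exact: (cvgMl_tmp (F := nbhs (y, 0))
    (continuous_comp (sc (y, 0)) (@monomial_quotient_continuous _ _ i m _))).
have qE (y : 'rV[R]_n) (t : R) : (forall j, `|(y - x) 0 j| <= r / 2) -> `|t| <= r / 2 ->
    f (t *: delta_mx 0 i + y) - f y = t * q (y, t).
  move=> yx tr.
  have yE : partial_sum (fun m => c m * monomial m (y - x)) @ totally --> f y.
    by apply: fE => j; apply: le_trans (yx j) _; lra.
  have ytE : partial_sum (fun m => c m * monomial m (t *: delta_mx 0 i + y - x)) @ totally
      --> f (t *: delta_mx 0 i + y).
    apply: fE => j; rewrite -addrA; move: (y - x) yx => z /(_ j) zr.
    rewrite !mxE eqxx /=; apply: le_trans (ler_normD _ _) _.
    by case: (j == i); rewrite ?mulr1 ?mulr0 ?normr0; lra.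
  have tq := cvgMl_tmp (a := t) (dominated_series_cvg sumb (Fb (y, t) yx tr)).
  have eq_sums : (partial_sum (fun m => c m * monomial m (t *: delta_mx 0 i + y - x))
      - partial_sum (fun m => c m * monomial m (y - x)))
      = (fun J => t * partial_sum (F (y, t)) J).
    apply/funext => J; rewrite -[LHS]/(partial_sum _ J - partial_sum _ J) !partial_sumE.
    rewrite mulr_sumr -sumrB; apply: eq_bigr => m _.
    by rewrite /F [RHS]mulrCA -monomial_quotientE -mulrBr [t *: _ + y]addrC addrAC.
  have := cvgB ytE yE; rewrite eq_sums => diffE.
  exact: (cvg_unique (@norm_hausdorff _ R) (diffE _) (tq _)).
have dE (y : 'rV[R]_n) : (forall j, `|(y - x) 0 j| <= r / 4) ->
    'D_(delta_mx 0 i) f y = q (y, 0).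
  move=> yx; apply/cvg_lim => //.
  have qt : q (y, t) @[t --> 0^'] --> q (y, 0).
    have pc : {for 0 : R, continuous (fun t : R => (y, t))}.
      exact: (cvg_pair (F := nbhs (0 : R)) (cvg_cst y) cvg_id).
    exact: cvg_within_filter (continuous_comp pc (qc _ yx)).
  apply: cvg_trans qt; apply: near_eq_cvg.
  near=> t.
  rewrite /= qE; first by rewrite /GRing.scale/= mulKf//; near: t; exact: nbhs_dnbhs_neq.
  - by move=> j; apply: le_trans (yx j) _; lra.
  - by near: t; apply: dnbhs0_le.
have r40 : 0 < r / 4 by lra.
apply: (@continuous_at_near_eq _ _ _ (fun y => q (y, 0))).
  by apply: filterS (near_coord_le x r40) => y /dE.
have pc : {for x, continuous (fun y : 'rV[R]_n => (y, 0 : R))}.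
  exact: (cvg_pair (F := nbhs x) cvg_id (cvg_cst (0 : R))).
apply: (continuous_comp pc); apply: qc => j.
by rewrite subrr mxE normr0 ltW.
Unshelve. all: by end_near. Qed.

(** * The gradient norm between two level sets *)

Lemma gradient_norm_continuous (R : realType) (n : nat) (X : set 'rV[R]_n)
    (f : 'rV[R]_n -> R) (x : 'rV[R]_n) :
  real_analytic_on X f -> X x -> {for x, continuous (fun y => enorm (gradient f y))}.
Proof.
move=> fX Xx.
have sumc : {for x, continuous (fun y => \sum_(i < n) (gradient f y) 0 i ^+ 2)}.
  apply: (cvg_big (F := nbhs x) (@add_continuous R)) => i _.
  have gc : {for x, continuous (fun y => (gradient f y) 0 i)}.
    rewrite (_ : (fun y => _) = (fun y => 'D_(delta_mx 0 i) f y)).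
      exact: analytic_partial_continuous fX Xx.
    by apply/funext => y; rewrite mxE.
  exact: (continuous_comp gc (@exprn_continuous R 2 _)).
exact: (continuous_comp sumc (@sqrt_continuous R _)).
Qed.

(** X need not be closed, so the lower bound on f is imposed by removing the open
set of points of X below lo. *)
Lemma compact_band (R : realType) (n : nat) (X : set 'rV[R]_n) (f : 'rV[R]_n -> R)
    (lo hi : R) :
  open X -> (forall x, X x -> {for x, continuous f}) -> proper_on X f ->
  compact [set x | [/\ X x, lo <= f x & f x <= hi]].
Proof.
move=> oX fc fp.
have oL : open [set x | X x /\ f x < lo].
  rewrite openE => x [Xx fx]; rewrite /interior.
  have nX : nbhs x X by exact: open_nbhs_nbhs.
  have nf : \forall y \near x, f y < lo by exact: (cvgr_lt _ (fc _ Xx)).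
  exact: (filterI nX nf).
have -> : [set x | [/\ X x, lo <= f x & f x <= hi]] =
    [set x | X x /\ f x <= hi] `&` ~` [set x | X x /\ f x < lo].
  apply/seteqP; split=> x /=.
    by move=> [Xx lx xh]; split=> // -[_]; rewrite ltNge lx.
  move=> [[Xx xh] nL]; split=> //; rewrite leNgt; apply/negP => ?; exact: nL.
by apply: compact_closedI; [exact: fp | exact: open_closedC].
Qed.

(** Pointwise positivity becomes a uniform bound by compactness. *)
Lemma gradient_lower_bound_band (R : realType) (n : nat) (X : set 'rV[R]_n)
    (f : 'rV[R]_n -> R) (alpha : R -> R) (lo hi : R) :
  open X -> real_analytic_on X f -> proper_on X f ->
  classPD alpha -> gradient_lower_bound X f alpha -> 0 < lo ->
  exists2 c : R, 0 < c & forall x, X x ->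
    lo <= f x - infimum_on X f -> f x - infimum_on X f <= hi ->
    c <= enorm (gradient f x).
Proof.
move=> oX fX fp [_ alpha_gt0] alphaP lo0; set m := infimum_on X f.
pose K := [set x | [/\ X x, lo + m <= f x & f x <= hi + m]].
have cK : compact K by apply: compact_band => // x; exact: analytic_continuous fX.
have [K0|] := pselect (K !=set0); last first.
  move=> K0; exists 1 => // x Xx lx xh; exfalso; apply: K0; exists x; split=> //; lra.
have wc : {within K, continuous (fun y => enorm (gradient f y))}.
  apply: continuous_in_subspaceT => x /set_mem[Xx _ _].
  exact: gradient_norm_continuous fX Xx.
have [x /set_mem[Xx lx xh] xmin] := EVT_min_rV K0 cK wc.
exists (enorm (gradient f x)).
  apply: lt_le_trans (alphaP _ Xx); apply: alpha_gt0; rewrite -/m; lra.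
by move=> y Xy ly yh; apply: xmin; apply/mem_set; split=> //; lra.
Qed.

Lemma limf_einf_pinfty_gt0 (R : realType) (alpha : R -> R) :
  (0 < limf_einf (fun r : R => (alpha r)%:E) +oo%R)%E <->
  exists c M : R, 0 < c /\ forall r, M < r -> c <= alpha r.
Proof.
rewrite limf_einfE; split.
  move=> /ereal_sup_gt[_ [V [M [_ MV]] <-]] infV.
  have lbV r : M < r -> (ereal_inf ((fun r : R => (alpha r)%:E) @` V) <= (alpha r)%:E)%E.
    by move=> Mr; apply: ereal_inf_lbound; exists r => //; exact: MV.
  case: ereal_inf infV lbV => [c|_ lbV|//].
    by rewrite lte_fin => c0 lbV; exists c, M; split=> // r /lbV; rewrite lee_fin.
  by have := lbV (M + 1); rewrite ltrDl ltr01 => /(_ isT).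
move=> [c [M [c0 alphac]]].
apply: (@lt_le_trans _ _ c%:E); first by rewrite lte_fin.
apply: (@le_trans _ _ (ereal_inf ((fun r : R => (alpha r)%:E) @` [set r | M < r]))).
  by apply: le_ereal_inf_tmp => _ [r Mr <-]; rewrite lee_fin; exact: alphac.
apply: ereal_sup_ubound; exists [set r | M < r] => //.
by exists M; split=> //; exact: num_real.
Qed.

Unset Implicit Arguments.

Theorem lemma5 (R : realType) (n : nat) (X : set 'rV[R]_n) (f : 'rV[R]_n -> R)
    (X_nonempty : X !=set0) (X_open : open X)
    (f_analytic : real_analytic_on X f)
    (f_bounded_below : bounded_below_on X f)
    (f_proper : proper_on X f) :
  (exists alpha : R -> R, classKSAT alpha /\ gradient_lower_bound X f alpha)
  <->
  (local_PL X f /\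
   exists alpha : R -> R,
     [/\ classPD alpha, gradient_lower_bound X f alpha &
         (0 < limf_einf (fun r : R => (alpha r)%:E) +oo%R)%E]).
Proof.
have gap_ge0 x : X x -> 0 <= f x - infimum_on X f.
  by move=> Xx; rewrite subr_ge0; apply: ge_inf => //; exists x.
split.
- move=> [alpha [[a [b [a0 b0 alphaE]]] alphaP]]; split.
    exists b, (a / (b *+ 2)); split=> [//||x Xx gap_b]; first by rewrite divr_gt0// mulrn_wgt0.
    apply: le_trans (alphaP x Xx); move: (gap_ge0 x Xx) gap_b.
    move: (f x - _) => r r0 rb; rewrite alphaE//; apply: ler_wsqrtr.
    rewrite mulrAC ler_wpM2l ?mulr_ge0//; first by lra.
    by rewrite lef_pV2 ?posrE; lra.
  exists alpha; split=> //.
    split=> [|r r0]; first by rewrite alphaE// mulr0 mul0r sqrtr0.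
    by rewrite alphaE ?(ltW r0)// sqrtr_gt0 divr_gt0 ?mulr_gt0//; lra.
  apply/limf_einf_pinfty_gt0; exists (Num.sqrt (a / 2)), b; split.
    by rewrite sqrtr_gt0 divr_gt0.
  move=> r br; rewrite alphaE; last by lra.
  apply: ler_wsqrtr; rewrite ler_pdivlMr; last by lra.
  nra.
- move=> [[eps [mu [eps0 mu0 PL]]] [alpha [alphaPD alphaP /limf_einf_pinfty_gt0]]].
  move=> [c1 [M [c10 alphac]]].
  have [c2 c20 c2P] := gradient_lower_bound_band M X_open f_analytic f_proper
    alphaPD alphaP eps0.
  pose c := Num.min c1 c2; pose a := Num.min mu (c ^+ 2).
  have c0 : 0 < c by rewrite lt_min c10.
  have a0 : 0 < a by rewrite lt_min mu0 exprn_gt0.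
  exists (fun r => Num.sqrt (a * r / (1 + r))); split; first by exists a, 1.
  move=> x Xx; have r0 := gap_ge0 x Xx.
  have [small|large] := leP (f x - infimum_on X f) eps.
    apply: le_trans (PL x Xx small); apply: ler_wsqrtr.
    move: (f x - _) r0 {small} => r r0; rewrite ler_pdivrMr; last by lra.
    have amu : a <= mu by rewrite ge_min lexx.
    nra.
  apply: (@le_trans _ _ c).
    rewrite -[leRHS](gtr0_norm c0) -sqrtr_sqr; apply: ler_wsqrtr.
    move: (f x - _) r0 {large} => r r0; rewrite ler_pdivrMr; last by lra.
    have ac : a <= c ^+ 2 by rewrite ge_min lexx orbT.
    nra.
  have [mid|far] := leP (f x - infimum_on X f) M.
    by apply: le_trans (c2P x Xx (ltW large) mid); rewrite ge_min lexx orbT.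
  by apply: le_trans (alphaP x Xx); apply: le_trans (alphac _ far); rewrite ge_min lexx.
Qed.
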